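(* Let $\mathfrak{E},\mathfrak{H},\mathfrak{K}$ be Hilbert spaces and let $A\in\mathbf{B}(\mathfrak{E},\mathfrak{H})$ and $B\in\mathbf{B}(\mathfrak{E},\mathfrak{K})$ be bounded linear operators. Then the Lebesgue type decompositions of $B$ with respect to $A$ are in one-to-one correspondence with the closed linear subspaces $\mathfrak{L}\subset\mathfrak{K}$ such that $$\mathfrak{L}\subset\operatorname{clos}\mathfrak{D}(A,B),\qquad \mathfrak{L}\cap\mathfrak{D}(A,B)=\{0\},$$ and $$\operatorname{clos}\bigl(\mathfrak{L}^\perp\cap\mathfrak{D}(A,B)\bigr)=\mathfrak{L}^\perp\cap\operatorname{clos}\mathfrak{D}(A,B).$$ The Lebesgue type decomposition corresponding to $\mathfrak{L}$ is given by $$B=B_1+B_2,\qquad B_1=(I-P_{\mathfrak{M}})B,\qquad B_2=P_{\mathfrak{M}}B,$$ where $\mathfrak{M}=\mathfrak{D}(A,B)^\perp\oplus\mathfrak{L}$ and $P_{\mathfrak{M}}$ is the orthogonal projection from $\mathfrak{K}$ onto $\mathfrak{M}$; here $B_1$ is almost dominated by $A$ and $B_2$ is singular with respect to $A$. The part $B_1$ can be written as $B_1=R(A,B_1)A$, where $R(A,B_1)=L(A,B_1)^{**}$ is the Radon-Nikodym derivative of $B_1$ with respect to $A$. Moreover, linear relations $L(A,B)_1$ and $L(A,B)_2$ are the components $L(A,B)_1=(I-P_{\mathfrak{M}})L(A,B)$, $L(A,B)_2=P_{\mathfrak{M}}L(A,B)$ of the corresponding decomposition $L(A,B)=L(A,B)_1+L(A,B)_2$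 precisely when $L(A,B)_1=L(A,B_1)$ and $L(A,B)_2=L(A,B_2)$.
   Context: $\mathbf{B}(\mathfrak{X},\mathfrak{Y})$ denotes the everywhere defined bounded linear operators from the Hilbert space $\mathfrak{X}$ to the Hilbert space $\mathfrak{Y}$; $\mathbf{B}(\mathfrak{X})=\mathbf{B}(\mathfrak{X},\mathfrak{X})$. A linear relation $T$ from $\mathfrak{H}$ to $\mathfrak{K}$ is a linear subspace of $\mathfrak{H}\times\mathfrak{K}$, with elements written $\{f,g\}$; operators are identified with their graphs. $T^{**}$ is the closure of $T$ in $\mathfrak{H}\times\mathfrak{K}$. For $Q\in\mathbf{B}(\mathfrak{K})$, $QT=\{\{f,Qg\}:\{f,g\}\in T\}$. The sum of relations is $T_1+T_2=\{\{f,g_1+g_2\}:\{f,g_1\}\in T_1,\{f,g_2\}\in T_2\}$. For $A\in\mathbf{B}(\mathfrak{E},\mathfrak{H})$, $B\in\mathbf{B}(\mathfrak{E},\mathfrak{K})$: $L(A,B)=\{\{Af,Bf\}: f\in\mathfrak{E}\}$, a linear relation from $\mathfrak{H}$ to $\mathfrak{K}$, and $\mathfrak{D}(A,B)=\{k\in\mathfrak{K}: B^*k\in\operatorname{ran}A^*\}$ (this equals $\operatorname{dom}L(A,B)^*$). $D\prec A$ ($D$ is dominated by $A$) means there is $c>0$ with $\|Df\|\le c\|Af\|$ for all $f\in\mathfrak{E}$. $B$ is almost dominated by $A$ if there exist Hilbert spaces $\mathfrak{K}_n$, operators $B_n\in\mathbf{B}(\mathfrak{E},\mathfrak{K}_n)$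 and numbers $c_n\ge0$ such that for all $f\in\mathfrak{E}$: (a) $\|B_nf\|\le c_n\|Af\|$; (b) $\|B_nf\|\le\|B_{n+1}f\|$; (c) $\|B_nf\|\nearrow\|Bf\|$. $B$ is singular with respect to $A$ if for every $D\in\mathbf{B}(\mathfrak{E})$: $D\prec A$ and $D\prec B$ imply $D=0$. A Lebesgue type decomposition of $B$ with respect to $A$ is a decomposition $B=B_1+B_2$ with $B_1,B_2\in\mathbf{B}(\mathfrak{E},\mathfrak{K})$ such that $\operatorname{ran}B_1\perp\operatorname{ran}B_2$, $B_1$ is almost dominated by $A$, and $B_2$ is singular with respect to $A$. If $B$ is almost dominated by $A$, then $L(A,B)^{**}$ is (the graph of) a closed linear operator from $\mathfrak{H}$ to $\mathfrak{K}$ (not necessarily densely defined or bounded), and the Radon-Nikodym derivative of $B$ with respect to $A$ is $R(A,B)=L(A,B)^{**}$. *)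

(* Defs.v *)
From HB Require Import structures.
From mathcomp Require Import all_boot all_order all_algebra.
From mathcomp Require Import all_classical all_reals all_analysis.
From mathcomp Require Import complex.

Set Implicit Arguments.
Unset Strict Implicit.
Unset Printing Implicit Defensive.

Import Order.TTheory GRing.Theory Num.Theory.
Import numFieldNormedType.Exports.

Local Open Scope classical_set_scope.
Local Open Scope ring_scope.

(* Complex Hilbert spaces.  The norm of a normed module over R[i] takes its
   values in R[i]; in R[i], [0 <= z] means that z is real and nonnegative.
   The inner product is linear in its first argument. *)
HB.mixin Record isHilbert (R : realType) H of CompleteNormedModule R[i] H := {
  inner : {dot H for (@Num.conj R[i])} ;
  inner_normE : forall x : H, `|x| ^+ 2 = inner x x
}.

#[short(type="hilbertType")]
HB.structure Definition Hilbert (R : realType) :=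
  {H of isHilbert R H & CompleteNormedModule R[i] H}.

Section defs.
Variable R : realType.
Implicit Types E H K : hilbertType R.

(* B(E, H): everywhere defined bounded linear operators. *)
Definition bounded_op E H : set (E -> H) :=
  [set T | linear T /\ exists c : R[i], forall f, `|T f| <= c * `|f|].

(* The junk value 0 is never taken when T is in B(E, H) (Riesz). *)
Definition adjoint E H (T : E -> H) : H -> E :=
  fun h => xget 0 [set e | forall f, inner (T f) h = inner f e].

Definition orthocompl K (S : set K) : set K :=
  [set k | forall s, S s -> inner k s = 0].

Definition sum_set K (S T : set K) : set K :=
  [set z | exists x y, [/\ S x, T y & z = x + y]].

(* The junk value 0 is never taken when M is a closed linear subspace. *)
Definition orthoproj K (M : set K) : K -> K :=
  fun k => xget 0 [set m | M m /\ orthocompl M (k - m)].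

Definition closed_subspace K (L : set K) : Prop :=
  submod_closed (mem L) /\ closed L.

(* A linear relation from H to K is a linear subspace of H * K. *)
Definition linear_relation H K (T : set (H * K)) : Prop :=
  submod_closed (mem T).

Definition graph H K (T : H -> K) : set (H * K) := [set p | p.2 = T p.1].

Definition rel_sum H K (T1 T2 : set (H * K)) : set (H * K) :=
  [set p | exists g1 g2, [/\ T1 (p.1, g1), T2 (p.1, g2) & p.2 = g1 + g2]].

(* The product S T of the relations T and S: T is applied first. *)
Definition rel_comp E H K (S : set (H * K)) (T : set (E * H)) : set (E * K) :=
  [set p | exists h, T (p.1, h) /\ S (h, p.2)].

(* Q T for an everywhere defined operator Q. *)
Definition op_rel H K (Q : K -> K) (T : set (H * K)) : set (H * K) :=
  [set (p.1, Q p.2) | p in T].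

Definition is_operator H K (T : set (H * K)) : Prop :=
  forall h g1 g2, T (h, g1) -> T (h, g2) -> g1 = g2.

Section pair.
Variables E H K : hilbertType R.
Implicit Types (A : E -> H) (B : E -> K).

Definition Lrel A B : set (H * K) := range (fun f => (A f, B f)).

Definition Ddom A B : set K :=
  [set k | range (adjoint A) (adjoint B k)].

(* For a linear relation T, T^** is the closure of T in H * K. *)
Definition RN A B : set (H * K) := closure (Lrel A B).

(* [dominated A D] is D \prec A; likewise [almost_dominated A B] and
   [singular A B] say that B is almost dominated by, resp. singular with
   respect to, A. *)
Definition dominated A B : Prop :=
  exists2 c : R[i], 0 < c & forall f, `|B f| <= c * `|A f|.

Definition almost_dominated A B : Prop :=
  exists (Kn : nat -> hilbertType R) (Bn : forall n, E -> Kn n) (c : nat -> R[i]),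
    [/\ forall n, bounded_op (Bn n),
        forall n, 0 <= c n
      & forall f,
        [/\ forall n, `|Bn n f| <= c n * `|A f|,
            forall n, `|Bn n f| <= `|Bn n.+1 f|
          & (fun n => `|Bn n f| : R[i]^o) @ \oo --> (`|B f| : R[i]^o)]].
End pair.

Definition singular E H K (A : E -> H) (B : E -> K) : Prop :=
  forall D : E -> E, bounded_op D -> dominated A D -> dominated B D ->
    forall f, D f = 0.

Section decompositions.
Variables E H K : hilbertType R.
Implicit Types (A : E -> H) (B : E -> K) (L : set K).

Definition lebesgue_decomposition A B (B12 : (E -> K) * (E -> K)) : Prop :=
  let: (B1, B2) := B12 in
  [/\ bounded_op B1 /\ bounded_op B2,
      forall f, B f = B1 f + B2 f,
      forall f g, inner (B1 f) (B2 g) = 0,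
      almost_dominated A B1
    & singular A B2].

Definition admissible A B L : Prop :=
  [/\ closed_subspace L,
      L `<=` closure (Ddom A B),
      L `&` Ddom A B = [set 0]
    & closure (orthocompl L `&` Ddom A B)
      = orthocompl L `&` closure (Ddom A B)].

Definition Mspace A B L : set K := sum_set (orthocompl (Ddom A B)) L.

(* P_M and I - P_M for M = D(A,B)^\perp (+) L. *)
Definition PM A B L : K -> K := orthoproj (Mspace A B L).
Definition PMc A B L : K -> K := fun k => k - PM A B L k.
End decompositions.

End defs.

(* Main.v *)
Require Import Defs.
From HB Require Import structures.
From mathcomp Require Import all_boot all_order all_algebra.
From mathcomp Require Import all_classical all_reals all_analysis.
From mathcomp Require Import complex ring lra.

Set Implicit Arguments.
Unset Strict Implicit.
Unset Printing Implicit Defensive.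

Import Order.TTheory GRing.Theory Num.Theory.
Import numFieldNormedType.Exports.

Local Open Scope classical_set_scope.
Local Open Scope ring_scope.
Local Open Scope complex_scope.

(** Write [D] for [Ddom A B].  The theorem rests on two dualities, both
    phrased in terms of the subspace [D(A, C)], which consists of the [k] for
    which the functional [f |-> (C f, k)] has the form [f |-> (A f, h)].

    - [C] is singular with respect to [A] iff [(C f, k) = 0] for all [f] and
      all [k] in [D(A, C)] ([singularP]).  A functional dominated both by [A]
      and by [C] is represented on both sides, hence produces such a [k];
      conversely each such [k] gives the dominated rank one operator
      [f |-> (f, e) e] with [e = C^* k].
    - [C] is almost dominated by [A] iff the closure of [L(A, C)] is an
      operator, iff [D(A, C)] is dense.  The first implication is an estimate
      ([almost_dominated_operator]), the second one projects [(0, x)] onto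
      the closure of [L(A, C)] ([operator_domain_total]).  For the way back
      ([dense_almost_dominated]) let [(v, u)] be the point of the closure of
      [L(A, C)] that minimises [|u|^2 + s^2 |A f - v|^2], and put
      [C_s f = u].  Then [|C_s f| <= s |A f|], the norm [|C_s f|] increases
      with [s], and density of [D(A, C)] gives [|C_s f| -> |C f|].

    Now let [P] be the orthogonal projection onto [M].  Computing [D(A, P B)]
    and [D(A, (I - P) B)] in terms of [D] turns the requirements that [P B] be
    singular and [(I - P) B] almost dominated into: [M] meets [D] only in 0,
    and [M^\perp] meets [D] in a dense subspace of [M^\perp].  This is the
    predicate [splits D M].  Such an [M] automatically contains [D^\perp], so
    that [M = D^\perp (+) L] with [L = M \cap clos D], and [splits D M] becomes
    the admissibility of [L] ([sum_set_splits], [splits_admissible]).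

    Every decomposition arises in this way from [M = clos ran B_2]
    ([decomposition_splits]).  The subspace [M] is determined by [P B]
    ([proj_comp_inj]): if [P B = P' B] and [n = P k - P' k], then [P n] and
    [P' n] are orthogonal to [ran B], and such vectors belong to [D]; hence
    [P n = P' n = 0], and so [|n|^2 = (n, P k - P' k) = 0].

    All the analytic input (Riesz representation, projections, adjoints, the
    minimisers above) comes from one minimisation argument, [riesz].  The
    estimates use the underlying real inner product [Re (x, y)]; complex
    scalars come back through [rip_inner]. *)

(** * The underlying real inner product *)

Section real_structure.
Variable R : realType.
Implicit Types H K : hilbertType R.

Definition nrm H (x : H) : R := complex.Re `|x|.
Definition rip H (x y : H) : R := complex.Re (inner x y).

Lemma innerDl H (x y z : H) : inner (x + y) z = inner x z + inner y z.
Proof. exact: linearDl. Qed.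

Lemma innerZl H (t : R[i]) (x z : H) : inner (t *: x) z = t * inner x z.
Proof. exact: linearZl_LR. Qed.

Lemma innerDr H (x y z : H) : inner z (x + y) = inner z x + inner z y.
Proof. exact: linearDr. Qed.

Lemma innerZr H (t : R[i]) (x z : H) : inner z (t *: x) = Num.conj t * inner z x.
Proof. exact: linearZr_LR. Qed.

Lemma inner0l H (x : H) : inner 0 x = 0.
Proof. exact: linear0l. Qed.

Lemma innerC H (x y : H) : inner x y = Num.conj (inner y x).
Proof. by rewrite (hermC (@inner R H) x y) expr0 mul1r. Qed.

Lemma nrmE H (x : H) : `|x| = (nrm x)%:C.
Proof. by rewrite /nrm RRe_real // ger0_real. Qed.

Let ReD (a b : R[i]) : complex.Re (a + b) = complex.Re a + complex.Re b.
Proof. by case: a b => [? ?] []. Qed.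

Let ReJ (a : R[i]) : complex.Re (Num.conj a) = complex.Re a.
Proof. by case: a. Qed.

Let ReZ (t : R) (a : R[i]) : complex.Re (t%:C * a) = t * complex.Re a.
Proof. by case: a => a b /=; rewrite mul0r subr0. Qed.

Let Rei (a : R[i]) : complex.Re ('i%C * a) = - complex.Im a.
Proof. by case: a => a b /=; rewrite mul0r mul1r sub0r. Qed.

Lemma ripDl H (x y z : H) : rip (x + y) z = rip x z + rip y z.
Proof. by rewrite /rip innerDl ReD. Qed.

Lemma ripC H (x y : H) : rip x y = rip y x.
Proof.
by rewrite /rip innerC ReJ.
Qed.

Lemma ripDr H (x y z : H) : rip z (x + y) = rip z x + rip z y.
Proof. by rewrite ![rip z _]ripC ripDl. Qed.

Lemma ripZl H (t : R) (x z : H) : rip (t%:C *: x) z = t * rip x z.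
Proof.
by rewrite /rip innerZl ReZ.
Qed.

Lemma ripZr H (t : R) (x z : H) : rip x (t%:C *: z) = t * rip x z.
Proof. by rewrite ripC ripZl ripC. Qed.

Lemma ripNl H (x z : H) : rip (- x) z = - rip x z.
Proof.
rewrite -[- x](_ : (-1)%:C *: x = _) ?ripZl ?mulN1r //.
by rewrite rmorphN1 scaleN1r.
Qed.

Lemma ripNr H (x z : H) : rip z (- x) = - rip z x.
Proof. by rewrite ripC ripNl ripC. Qed.

Lemma rip0l H (x : H) : rip 0 x = 0.
Proof. by rewrite /rip inner0l. Qed.

Lemma rip0r H (x : H) : rip x 0 = 0.
Proof. by rewrite ripC rip0l. Qed.

Definition ripE := (ripDl, ripDr, ripNl, ripNr, ripZl, ripZr, rip0l, rip0r).

Lemma rip_i H (x y : H) : rip ('i%C *: x) y = - complex.Im (inner x y).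
Proof. by rewrite /rip innerZl Rei. Qed.

Lemma nrm_sq H (x : H) : nrm x ^+ 2 = rip x x.
Proof.
by rewrite /rip -inner_normE nrmE -(rmorphXn (real_complex R)).
Qed.

Lemma nrm_ge0 H (x : H) : 0 <= nrm x.
Proof. by rewrite -ler0c -nrmE. Qed.

Lemma nrm_eq0 H (x : H) : nrm x = 0 -> x = 0.
Proof. by move=> h; apply/eqP; rewrite -normr_eq0 nrmE h. Qed.

Lemma nrm0 H : nrm (0 : H) = 0.
Proof. by rewrite /nrm normr0. Qed.

Lemma nrmD H (x y : H) : nrm (x + y) <= nrm x + nrm y.
Proof. by rewrite -lecR rmorphD /= -!nrmE ler_normD. Qed.

Lemma nrmN H (x : H) : nrm (- x) = nrm x.
Proof. by rewrite /nrm normrN. Qed.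

Lemma nrmBC H (x y : H) : nrm (x - y) = nrm (y - x).
Proof. by rewrite -nrmN opprB. Qed.

Lemma nrm_triangle H (y x z : H) : nrm (x - z) <= nrm (x - y) + nrm (y - z).
Proof. by rewrite -[X in nrm X](subrKA y) nrmD. Qed.

Lemma nrmZ H (a : R[i]) (x : H) : nrm (a *: x) = complex.Re `|a| * nrm x.
Proof.
have -> : nrm (a *: x) = complex.Re (`|a| * (nrm x)%:C) by rewrite -nrmE -normrZ.
by rewrite mulrC ReZ mulrC.
Qed.

Lemma nrmZr H (t : R) (x : H) : nrm (t%:C *: x) = `|t| * nrm x.
Proof. by rewrite nrmZ normc_def /= expr0n addr0 sqrtr_sqr. Qed.

(** Cauchy-Schwarz: expand [| |y| x - |x| y |^2 >= 0]. *)
Lemma rip_le H (x y : H) : rip x y <= nrm x * nrm y.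
Proof.
have [y0|yn0] := eqVneq (nrm y) 0.
  by rewrite (nrm_eq0 y0) rip0r mulr_ge0 ?nrm_ge0.
have yp : 0 < nrm y by rewrite lt_neqAle eq_sym yn0 nrm_ge0.
have h : 0 <= nrm ((nrm y)%:C *: x - (nrm x)%:C *: y) ^+ 2 by apply: sqr_ge0.
move: h; rewrite nrm_sq !ripE -!nrm_sq (ripC y x) => h.
have [x0|xn0] := eqVneq (nrm x) 0.
  by rewrite (nrm_eq0 x0) rip0l mulr_ge0 ?nrm_ge0.
have xp : 0 < nrm x by rewrite lt_neqAle eq_sym xn0 nrm_ge0.
rewrite -(ler_pM2l (mulr_gt0 xp yp)).
nra.
Qed.

Lemma rip_ge H (x y : H) : - (nrm x * nrm y) <= rip x y.
Proof. by rewrite lerNl -ripNl -(nrmN x) rip_le. Qed.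

(** The constant [c] of a complex bound may fail to be real only when [x = 0];
    its real part always serves as a real bound. *)
Lemma normC_le (E H : hilbertType R) (c : R[i]) (x : E) (y : H) :
  (`|y| <= c * `|x|) -> nrm y <= complex.Re c * nrm x.
Proof. by rewrite !nrmE lecE; case: c => a b /= /andP[_]; rewrite mulr0 subr0. Qed.

Lemma le_normC (E H : hilbertType R) (c : R) (x : E) (y : H) :
  (`|y| <= c%:C * `|x|) = (nrm y <= c * nrm x).
Proof. by rewrite !nrmE -rmorphM lecR. Qed.

(** The imaginary part of [(x, y)] is the real part of [(x, y)] with [x]
    replaced by [-i x]. *)
Lemma inner_eqP H K (x y : H) (x' y' : K) :
  rip x y = rip x' y' -> rip ('i%C *: x) y = rip ('i%C *: x') y' ->
  inner x y = inner x' y'.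
Proof.
rewrite !rip_i /rip.
move: (inner x y : R[i]) (inner x' y' : R[i]) => [a b] [a' b'] /= -> h.
by rewrite -[b]opprK h opprK.
Qed.

End real_structure.

(** * Closure and completeness in terms of real radii *)

Section topology.
Variable R : realType.
Implicit Types H K : hilbertType R.

Lemma epsC (e : R[i]) : 0 < e -> exists2 r : R, 0 < r & e = r%:C.
Proof.
case: e => a b; rewrite ltcE /= => /andP[/eqP -> a0]; by exists a.
Qed.

Lemma closureP K (S : set K) (x : K) :
  closure S x <-> forall e : R, 0 < e -> exists2 s, S s & nrm (x - s) < e.
Proof.
split=> [h e e0|h].
  have /h[s [Ss]] : nbhs x (ball x (e%:C : R[i])).
    by apply: nbhsx_ballx; rewrite ltcR.
  by rewrite -ball_normE /ball_ /= nrmE ltcR => ?; exists s.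
move=> U /nbhs_ballP[e /= /epsC[r r0 ->] sub].
have [s Ss xs] := h _ r0; exists s; split => //; apply: sub.
by rewrite -ball_normE /ball_ /= nrmE ltcR.
Qed.

Lemma closure_prodP H K (S : set (H * K)) (x : H * K) :
  closure S x <-> forall e : R, 0 < e ->
    exists s, [/\ S s, nrm (x.1 - s.1) < e & nrm (x.2 - s.2) < e].
Proof.
split=> [h e e0|h].
  have /h[s [Ss]] : nbhs x (ball x (e%:C : R[i])).
    by apply: nbhsx_ballx; rewrite ltcR.
  move=> [/=]; rewrite -!ball_normE /ball_ /= !nrmE !ltcR => ? ?.
  by exists s.
move=> U /nbhs_ballP[e /= /epsC[r r0 ->] sub].
have [s [Ss xs ys]] := h _ r0; exists s; split => //; apply: sub.
by split => /=; rewrite -ball_normE /ball_ /= nrmE ltcR.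
Qed.

Lemma hilbert_complete H (u : nat -> H) :
  (forall e : R, 0 < e -> exists N, forall m n, (N <= m)%N -> (N <= n)%N ->
     nrm (u m - u n) < e) ->
  exists l, forall e : R, 0 < e -> exists N, forall n, (N <= n)%N ->
     nrm (u n - l) < e.
Proof.
move=> cu.
have /cauchy_cvgP/cvg_ex[l lP] : cauchy (u @ \oo).
  apply/cauchy_ballP => _ /epsC[e e0 ->].
  have [N NP] := cu _ e0.
  near_simpl; exists (setT `&` [set n | (N <= n)%N], setT `&` [set n | (N <= n)%N]).
    by split => /=; rewrite setTI; exists N.
  move=> [m n] /= [[_ mN] [_ nN]].
  by rewrite -ball_normE /ball_ /= nrmE ltcR NP.
exists l => e e0.
have /cvgrPdist_lt/(_ (e%:C : R[i])) := lP.
rewrite ltcR => /(_ e0) [N _ NP]; exists N => n nN.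
by have := NP n nN; rewrite /= nrmE ltcR nrmBC.
Qed.

End topology.

(** * Linear maps and subspaces *)

Section linear_maps.
Variables (C : nzRingType) (U V : lmodType C).
Implicit Types f : U -> V.

Lemma lin0 f : linear f -> f 0 = 0.
Proof. by move=> hf; have := hf (-1) 0 0; rewrite !scaleN1r !addNr. Qed.

Lemma linD f x y : linear f -> f (x + y) = f x + f y.
Proof. by move=> hf; have := hf 1 x y; rewrite !scale1r. Qed.

Lemma linZ f t x : linear f -> f (t *: x) = t *: f x.
Proof. by move=> hf; have := hf t x 0; rewrite lin0 // !addr0. Qed.

Lemma linN f x : linear f -> f (- x) = - f x.
Proof. by move=> hf; rewrite -scaleN1r linZ // scaleN1r. Qed.

Lemma linB f x y : linear f -> f (x - y) = f x - f y.
Proof. by move=> hf; rewrite linD // linN. Qed.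

Lemma submodP (S : set U) :
  submod_closed (mem S) <-> S 0 /\ forall t u v, S u -> S v -> S (t *: u + v).
Proof.
split=> [[h0 hS]|[h0 hS]]; split.
- by move: h0; rewrite inE.
- by move=> t u v Su Sv; have := hS t u v; rewrite !inE; apply.
- by rewrite inE.
- by move=> t u v; rewrite !inE; apply: hS.
Qed.

End linear_maps.

(** * The representation theorem *)

Section riesz.
Variable R : realType.
Variables (V : lmodType R[i]) (H K : hilbertType R) (S : set V).
Variables (a : V -> H) (b : V -> K) (phi : V -> R) (c : R).
Hypotheses (sS : submod_closed (mem S)) (la : linear a) (lb : linear b).
Hypothesis lphi : forall (t : R) u v, phi (t%:C *: u + v) = t * phi u + phi v.
Hypothesis bphi : forall v, S v -> phi v <= c * (nrm (a v) + nrm (b v)).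

Let Szv t u v : S u -> S v -> S (t *: u + v).
Proof. by have /submodP[_] := sS; apply. Qed.

Let q u := rip (a u) (a u) + rip (b u) (b u).
Let J u := q u - 2 * phi u.

Let J_step (t : R) u v : J (t%:C *: u + v) =
  J v + 2 * t * (rip (a u) (a v) + rip (b u) (b v) - phi u) + t ^+ 2 * q u.
Proof.
rewrite /J /q lphi la lb !ripE (ripC (a v)) (ripC (b v)); ring.
Qed.

Let J_lb v : S v -> - (2 * c ^+ 2) <= J v.
Proof.
move=> /bphi h; rewrite /J /q -!nrm_sq.
by have := sqr_ge0 (nrm (a v) - c); have := sqr_ge0 (nrm (b v) - c); nra.
Qed.

Let S0 : S 0. Proof. by have /submodP[] := sS. Qed.

Let d := inf (J @` S).

Let hasd : has_inf (J @` S).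
Proof.
split; first by exists (J 0), 0.
by exists (- (2 * c ^+ 2)) => _ [v Sv <-]; apply: J_lb.
Qed.

Let d_le v : S v -> d <= J v.
Proof. by move=> Sv; apply: ge_inf; [case: hasd|exists v]. Qed.

Let near_min (e : R) : 0 < e -> exists2 v, S v & J v < d + e.
Proof.
by move=> e0; have [_ [v Sv <-] h] := inf_adherent e0 hasd; exists v.
Qed.

Let q_ge0 u : 0 <= q u.
Proof. by rewrite /q -!nrm_sq addr_ge0 ?sqr_ge0. Qed.

Let q_near (e f : R) u v : S u -> S v -> J u < d + e -> J v < d + f ->
  q (u - v) <= 2 * (e + f).
Proof.
move=> Su Sv Ju Jv.
have Sd : S (u - v) by rewrite -[u - v]addrC -scaleN1r; apply: Szv.
have /d_le := Szv (2^-1)%:C Sd Sv.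
have := J_step 1 (u - v) v; rewrite scale1r subrK.
rewrite J_step; set X := _ - phi _; nra.
Qed.

(** Minimise [J v = |a v|^2 + |b v|^2 - 2 phi v] over [S].  The bound on [phi]
    keeps [J] bounded below; by the parallelogram law, here in the form of
    [q_near], a minimising sequence has Cauchy images [a v] and [b v], whose
    limits [h] and [k] are the representing vectors because the first
    variation of [J] vanishes there.  Taking a pair of maps on a subspace of an
    arbitrary module makes this the Riesz theorem ([a = id], [b = 0]), the
    projection onto a closed subspace ([a = id] on [S]), the factorisation of a
    functional dominated by an operator ([b = 0]), and the projection onto the
    closure of a linear relation [L(a, b)], where no direct sum of Hilbert
    spaces has to be formed. *)
Lemma riesz : exists h k,
  (forall e : R, 0 < e ->
     exists v, [/\ S v, nrm (a v - h) < e & nrm (b v - k) < e]) /\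
  forall v, S v -> phi v = rip (a v) h + rip (b v) k.
Proof.
have /choice[v vP] : forall n : nat, exists v, S v /\ J v < d + n.+1%:R^-1.
  by move=> n; have [|v Sv Jv] := @near_min n.+1%:R^-1; [by rewrite invr_gt0|exists v].
have Cv (e : R) : 0 < e -> exists N, forall m n, (N <= m)%N -> (N <= n)%N ->
    q (v m - v n) < e ^+ 2.
  move=> e0; have e2 : 0 < e ^+ 2 / 4 by rewrite divr_gt0 ?exprn_gt0.
  have [N _ NP] := near_infty_natSinv_lt (PosNum e2).
  exists N => m n Nm Nn; have [Sm Jm] := vP m; have [Sn Jn] := vP n.
  have lm : m.+1%:R^-1 < e ^+ 2 / 4 := NP m Nm.
  have ln : n.+1%:R^-1 < e ^+ 2 / 4 := NP n Nn.
  have := q_near Sm Sn Jm Jn.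
  by move: (m.+1%:R^-1) (n.+1%:R^-1) lm ln => em en lm ln qmn; lra.
have lt_sq (x y : R) : 0 < y -> x ^+ 2 < y ^+ 2 -> x < y.
    move=> y0; apply: contraTT; rewrite -!leNgt => yx.
    by rewrite lerXn2r ?nnegrE //; lra.
have [h hP] : exists h, forall e : R, 0 < e -> exists N, forall n, (N <= n)%N ->
     nrm (a (v n) - h) < e.
  apply: hilbert_complete => e e0; have [N NP] := Cv _ e0.
  exists N => m n Nm Nn; apply: lt_sq => //; apply: le_lt_trans (NP m n Nm Nn).
  by rewrite /q -!nrm_sq linB // lerDl sqr_ge0.
have [k kP] : exists k, forall e : R, 0 < e -> exists N, forall n, (N <= n)%N ->
     nrm (b (v n) - k) < e.
  apply: hilbert_complete => e e0; have [N NP] := Cv _ e0.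
  exists N => m n Nm Nn; apply: lt_sq => //; apply: le_lt_trans (NP m n Nm Nn).
  by rewrite /q -!nrm_sq -linB // lerDr sqr_ge0.
have hk (e : R) : 0 < e ->
    exists w, [/\ S w, nrm (a w - h) < e, nrm (b w - k) < e & J w < d + e].
  move=> e0; have [N1 P1] := hP _ e0; have [N2 P2] := kP _ e0.
  have [N _ NP] := near_infty_natSinv_lt (PosNum e0).
  pose n := maxn N (maxn N1 N2).
  have [Sn Jn] := vP n; exists (v n); split => //.
  - by apply: P1; rewrite /n leq_max leq_max leqnn orbT.
  - by apply: P2; rewrite /n leq_max leq_max leqnn !orbT.
  by apply: lt_trans Jn _; rewrite ltrD2l; apply: NP; rewrite /= leq_max leqnn.
exists h, k; split=> [e /hk[w [? ? ? _]]|u Su]; first by exists w.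
set X := _ + _; pose Y := X - phi u.
suff : Y = 0 by move=> /eqP; rewrite subr_eq0 => /eqP.
pose N := nrm (a u) + nrm (b u).
have N0 : 0 <= N by rewrite addr_ge0 ?nrm_ge0.
have key (t : R) : 0 <= 2 * t * Y + t ^+ 2 * q u.
  have C0 : 0 < 1 + 2 * `|t| * N by rewrite ltr_pwDl // !mulr_ge0.
  apply/ler_addgt0Pr => e e0.
  have [w [Sw aw bw Jw]] := hk (e / (1 + 2 * `|t| * N)) (divr_gt0 e0 C0).
  set f := e / _ in aw bw Jw.
  have ef : e = f * (1 + 2 * `|t| * N) by rewrite mulfVK ?gt_eqF.
  have f0 : 0 < f by rewrite divr_gt0.
  have := d_le (Szv t%:C Su Sw); rewrite J_step; set Z := _ - phi u => dJ.
  have ZY : Z - Y = rip (a u) (a w - h) + rip (b u) (b w - k).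
    by rewrite /Z /Y /X !ripE; ring.
  have ZYN : `|Z - Y| <= N * f.
    rewrite ZY; apply: le_trans (ler_normD _ _) _; rewrite mulrDl.
    apply: lerD; rewrite ler_norml; apply/andP; split.
    - by apply: le_trans (rip_ge _ _); rewrite lerN2 ler_wpM2l ?nrm_ge0 ?ltW.
    - by apply: le_trans (rip_le _ _) _; rewrite ler_wpM2l ?nrm_ge0 ?ltW.
    - by apply: le_trans (rip_ge _ _); rewrite lerN2 ler_wpM2l ?nrm_ge0 ?ltW.
    - by apply: le_trans (rip_le _ _) _; rewrite ler_wpM2l ?nrm_ge0 ?ltW.
  have tZ : t * (Z - Y) <= `|t| * (N * f).
    by apply: le_trans (ler_norm _) _; rewrite normrM ler_wpM2l.
  rewrite ef; nra.
(* [- Y / (q u + 1)] minimises [2 t Y + t^2 (q u + 1)]. *)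
have Q1 : 0 < q u + 1 by rewrite ltr_wpDl.
have := key (- Y / (q u + 1)).
have -> : 2 * (- Y / (q u + 1)) * Y + (- Y / (q u + 1)) ^+ 2 * q u =
  - (Y ^+ 2 * (q u + 2)) / (q u + 1) ^+ 2 by field; rewrite gt_eqF.
rewrite pmulr_lge0 ?invr_gt0 ?exprn_gt0 // oppr_ge0 pmulr_lle0; last first.
  by rewrite ltr_wpDl.
move=> Y0; apply/eqP; rewrite -sqrf_eq0; apply/eqP/le_anti.
by rewrite Y0 sqr_ge0.
Qed.

End riesz.

(** * Orthogonal complements *)

Section orthogonal_complements.
Variable R : realType.
Implicit Types E H K : hilbertType R.

Lemma inner0C H (x y : H) : inner x y = 0 -> inner y x = 0.
Proof. by move=> h; rewrite innerC h rmorph0. Qed.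

(** Rotating [x] by the conjugate of [(x, y)] makes the inner product real, so
    the real Cauchy-Schwarz inequality applies. *)
Lemma inner_le H (x y : H) : complex.Re `|inner x y| <= nrm x * nrm y.
Proof.
set z := inner x y.
have nz0 : 0 <= complex.Re `|z| by rewrite -ler0c RRe_real ?ger0_real.
have h : complex.Re `|z| ^+ 2 = rip (Num.conj z *: x) y.
  have nzE : `|z| = (complex.Re `|z|)%:C by rewrite RRe_real ?ger0_real.
  rewrite /rip innerZl -/z mulrC -normCK [in RHS]nzE.
  by rewrite -(rmorphXn (real_complex R)).
have := rip_le (Num.conj z *: x) y; rewrite -h nrmZ norm_conjC expr2 -mulrA.
have [->|n0] := eqVneq (complex.Re `|z|) 0; first by rewrite mulr_ge0 ?nrm_ge0.
by rewrite ler_pM2l // lt_neqAle eq_sym n0.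
Qed.

Lemma rip_eq0 H (x : H) : (forall y, rip y x = 0) -> x = 0.
Proof.
move=> h; apply/nrm_eq0/eqP; rewrite -sqrf_eq0 nrm_sq h //.
Qed.

(** An identity between real parts on a complex subspace holds for the full
    inner products, since it may be applied to [i x] as well. *)
Lemma rip_inner (E : lmodType R[i]) H K (S : set E) (f : E -> H) (g : E -> K) h k :
  submod_closed (mem S) -> linear f -> linear g ->
  (forall x, S x -> rip (f x) h = rip (g x) k) ->
  forall x, S x -> inner (f x) h = inner (g x) k.
Proof.
move=> /submodP[S0 Sl] lf lg fg x Sx; apply: inner_eqP; first exact: fg.
rewrite -(linZ _ _ lf) -(linZ _ _ lg); apply: fg.
by rewrite -[_ *: x]addr0; apply: Sl.
Qed.

Lemma submodT (C : nzRingType) (V : lmodType C) : submod_closed (mem (@setT V)).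
Proof. by apply/submodP. Qed.

Lemma linear_id (C : nzRingType) (V : lmodType C) : linear (@id V).
Proof. by []. Qed.

Lemma linear_cst0 (C : nzRingType) (V W : lmodType C) : linear (fun _ : V => 0 : W).
Proof. by move=> t u v; rewrite scaler0 addr0. Qed.

Lemma orthocomplP K (S : set K) k : submod_closed (mem S) ->
  orthocompl S k <-> forall s, S s -> rip s k = 0.
Proof.
move=> sS; split=> [h s /h|h s Ss]; first by rewrite ripC /rip => ->.
apply: inner0C; have := @rip_inner _ _ _ S id (fun _ : K => 0 : K) k 0 sS.
move=> ->//; rewrite ?inner0l //; first exact: linear_cst0.
by move=> x Sx; rewrite rip0l h.
Qed.

Lemma orthocompl_submod K (S : set K) : submod_closed (mem (orthocompl S)).
Proof.
apply/submodP; split=> [s _|t u v hu hv s Ss]; first by rewrite inner0l.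
by rewrite innerDl innerZl hu // hv // mulr0 addr0.
Qed.

Lemma nrm_linear_diff H (t : R[i]) (u v u' v' : H) :
  nrm (t *: u + v - (t *: u' + v')) <=
    complex.Re `|t| * nrm (u - u') + nrm (v - v').
Proof.
rewrite opprD addrACA -scalerBr; apply: le_trans (nrmD _ _) _.
by rewrite nrmZ.
Qed.

Lemma closure_submod K (S : set K) :
  submod_closed (mem S) -> submod_closed (mem (closure S)).
Proof.
move=> /submodP[S0 Sl]; apply/submodP; split; first exact: subset_closure.
move=> t u v /closureP hu /closureP hv; apply/closureP => e e0.
set r := complex.Re `|t|.
have r0 : 0 <= r by rewrite -ler0c RRe_real ?ger0_real.
have d0 : 0 < e / (1 + r) by rewrite divr_gt0 // ltr_pwDl.
have [s Ss us] := hu _ d0; have [s' Ss' vs] := hv _ d0.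
exists (t *: s + s'); first exact: Sl.
apply: le_lt_trans (nrm_linear_diff _ _ _ _ _) _; rewrite -/r.
have -> : e = r * (e / (1 + r)) + e / (1 + r) by field; rewrite gt_eqF // ltr_pwDl.
by apply: ler_ltD => //; rewrite ler_wpM2l // ltW.
Qed.

Lemma rip_closure K (S : set K) x y : (forall s, S s -> rip s x = 0) ->
  closure S y -> rip y x = 0.
Proof.
move=> h /closureP cy; apply/eqP; rewrite -normr_le0; apply/ler_addgt0Pr => e e0.
rewrite add0r.
have [s Ss ys] := cy (e / (1 + nrm x)) (divr_gt0 e0 (ltr_pwDl ltr01 (nrm_ge0 x))).
have -> : rip y x = rip (y - s) x by rewrite ripDl ripNl (h s) // subr0.
have : `|rip (y - s) x| <= nrm (y - s) * nrm x.
  by rewrite ler_norml rip_le rip_ge.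
move=> /le_trans; apply; have := nrm_ge0 x => x0.
have -> : e = e / (1 + nrm x) * (1 + nrm x) by rewrite mulfVK // gt_eqF // ltr_pwDl.
by apply: ler_pM; rewrite ?nrm_ge0 ?ltW // ltrDr.
Qed.

Lemma orthocompl_closed K (S : set K) : submod_closed (mem S) ->
  closed (orthocompl S).
Proof.
move=> sS x cx; apply/orthocomplP => // s Ss.
rewrite ripC; apply: rip_closure cx => y /(orthocomplP _ sS) h.
by rewrite ripC h.
Qed.
End orthogonal_complements.

(** * Orthogonal projections *)

Section projections.
Variables (R : realType) (K : hilbertType R).
Implicit Types (S M : set K) (P : K -> K).

Lemma projection_ex S x : submod_closed (mem S) ->
  exists2 m, closure S m & orthocompl S (x - m).
Proof.
move=> sS.
have [] := @riesz R K K K S id (fun=> 0) (fun y => rip y x) (nrm x) sS.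
- exact: linear_id.
- exact: linear_cst0.
- by move=> t u v; rewrite !ripE.
- by move=> v _; rewrite nrm0 addr0 mulrC rip_le.
move=> m [k [cm mP]]; exists m.
  by apply/closureP => e /cm[v [Sv vm _]]; exists v; rewrite // nrmBC.
by apply/orthocomplP => // s Ss; rewrite !ripE mP // rip0l addr0 subrr.
Qed.

Lemma closure_orthocompl0 S : submod_closed (mem S) ->
  (forall x, orthocompl S x -> x = 0) -> closure S = setT.
Proof.
move=> sS h; apply/seteqP; split => // x _.
have [m cm /h/eqP] := projection_ex x sS.
by rewrite subr_eq0 => /eqP ->.
Qed.

(** [PM] and [PMc] are built on the choice operator [orthoproj]; working with
    this specification keeps the choice out of the arguments. *)
Definition is_proj M P := forall k, M (P k) /\ orthocompl M (k - P k).

Variables (M : set K) (P : K -> K).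
Hypotheses (sM : submod_closed (mem M)) (PP : is_proj M P).

Lemma proj_eq k m : M m -> orthocompl M (k - m) -> P k = m.
Proof.
move=> Mm om; have [MP oP] := PP k; have /submodP[_ Ml] := sM.
have Md : M (P k - m) by rewrite -[P k - m]addrC -scaleN1r; apply: Ml.
have /submodP[_ Ol] := orthocompl_submod M.
have od : orthocompl M (P k - m).
  have -> : P k - m = -1 *: (k - P k) + (k - m).
    by rewrite scaleN1r opprB addrA subrK.
  exact: Ol.
apply/eqP; rewrite -subr_eq0; apply/eqP/nrm_eq0/eqP.
by rewrite -sqrf_eq0 nrm_sq /rip od.
Qed.

Lemma proj_linear : linear P.
Proof.
move=> t u v; have [Mu ou] := PP u; have [Mv ov] := PP v.
have /submodP[_ Ol] := orthocompl_submod M; have /submodP[_ Ml] := sM.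
apply: proj_eq; first exact: Ml.
by rewrite opprD addrACA -scalerBr; apply: Ol.
Qed.

Lemma proj_sym x y : rip (P x) y = rip x (P y).
Proof.
have [Mx ox] := PP x; have [My oy] := PP y.
rewrite -[y in LHS](subrK (P y)) -[x in RHS](subrK (P x)).
rewrite ripDr (ripDl (x - P x)) (ripC _ (y - P y)).
by rewrite /rip (oy _ Mx) (ox _ My).
Qed.

Lemma proj_id x : M x -> P x = x.
Proof.
move=> Mx; apply: proj_eq => //; rewrite subrr.
by have /submodP[] := orthocompl_submod M.
Qed.

Lemma proj_nrm x : nrm x ^+ 2 = nrm (P x) ^+ 2 + nrm (x - P x) ^+ 2.
Proof.
have [Mx ox] := PP x.
have h : rip (x - P x) (P x) = 0 by rewrite /rip ox.
move: h; rewrite !nrm_sq !ripE (ripC (P x) x) => h.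
lra.
Qed.

Lemma proj_bound x : nrm (P x) <= nrm x.
Proof.
have := proj_nrm x; have := nrm_ge0 x; have := nrm_ge0 (P x).
have := sqr_ge0 (nrm (x - P x)) => *.
by rewrite -(ler_pXn2r (n:=2)) ?nnegrE //; lra.
Qed.

Lemma projC_bound x : nrm (x - P x) <= nrm x.
Proof.
have := proj_nrm x; have := nrm_ge0 x; have := nrm_ge0 (x - P x).
have := sqr_ge0 (nrm (P x)) => *.
by rewrite -(ler_pXn2r (n:=2)) ?nnegrE //; lra.
Qed.

End projections.

(** * Adjoints, the domain D(A, B) and singularity *)

Section operators.
Variable R : realType.
Implicit Types E H K : hilbertType R.

Lemma bounded_linear E H (T : E -> H) : bounded_op T -> linear T.
Proof. by case. Qed.

Lemma bounded_nrm E H (T : E -> H) : bounded_op T ->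
  exists c : R, forall f, nrm (T f) <= c * nrm f.
Proof. by move=> [_ [c hc]]; exists (complex.Re c) => f; apply: normC_le. Qed.

Lemma nrm_bounded E H (T : E -> H) c : linear T ->
  (forall f, nrm (T f) <= c * nrm f) -> bounded_op T.
Proof. by move=> lT hc; split => //; exists c%:C => f; rewrite le_normC. Qed.

(** Douglas' lemma for functionals: one that is bounded by [|A f|] factors
    through [A], hence is represented by a vector of [H]. *)
Lemma douglas E H (A : E -> H) (phi : E -> R) c : linear A ->
  (forall (t : R) u v, phi (t%:C *: u + v) = t * phi u + phi v) ->
  (forall f, phi f <= c * nrm (A f)) ->
  exists h, forall f, phi f = rip (A f) h.
Proof.
move=> lA lphi bphi.
have [] := @riesz R E H H setT A (fun=> 0) phi c (submodT _) lA _ lphi.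
- exact: linear_cst0.
- by move=> v _; rewrite nrm0 addr0.
by move=> h [k [_ hP]]; exists h => f; rewrite hP // rip0l addr0.
Qed.

Lemma adjointP E H (T : E -> H) (hT : bounded_op T) f h :
  inner (T f) h = inner f (adjoint T h).
Proof.
move: f.
suff : [set e | forall f, inner (T f) h = inner f e] !=set0.
  by rewrite /adjoint => -[e /(xgetI (0 : E))].
have lT := bounded_linear hT; have [c hc] := bounded_nrm hT.
have [] := @douglas E E id (fun f => rip (T f) h) (c * nrm h) (@linear_id _ _).
- by move=> t u v; rewrite lT !ripE.
- move=> f; apply: le_trans (rip_le _ _) _; rewrite mulrAC.
  by rewrite ler_wpM2r ?nrm_ge0.
move=> e eP; exists e => f /=.
apply: (@rip_inner _ _ _ _ setT T id) => //; exact: submodT.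
Qed.

Lemma rip_adjoint E H (T : E -> H) (hT : bounded_op T) f h :
  rip (T f) h = rip f (adjoint T h).
Proof. by rewrite /rip adjointP. Qed.

Section domain.
Variables (E H K : hilbertType R) (A : E -> H) (B : E -> K).
Hypotheses (hA : bounded_op A) (hB : bounded_op B).

Lemma DdomP k : Ddom A B k <-> exists h, forall f, rip (B f) k = rip (A f) h.
Proof.
split=> [[h _ hk]|[h hk]].
  by exists h => f; rewrite !rip_adjoint // hk.
exists h => //; apply/eqP; rewrite -subr_eq0; apply/eqP/rip_eq0 => f.
by rewrite ripDr ripNr -!rip_adjoint // hk subrr.
Qed.

Lemma Ddom_submod : submod_closed (mem (Ddom A B)).
Proof.
have cplx k : Ddom A B k -> exists h, forall f, inner (B f) k = inner (A f) h.
  by move=> [h _ hk]; exists h => f; rewrite !adjointP // hk.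
apply/submodP; split=> [|t u v /cplx[h hu] /cplx[h' hv]]; apply/DdomP.
  by exists 0 => f; rewrite !rip0r.
by exists (t *: h + h') => f; rewrite /rip !innerDr !innerZr hu hv.
Qed.

End domain.

Lemma dominated_nrm E H K (A : E -> H) (B : E -> K) : dominated A B ->
  exists c : R, forall f, nrm (B f) <= c * nrm (A f).
Proof. by move=> [c _ hc]; exists (complex.Re c) => f; apply: normC_le. Qed.

Lemma nrm_dominated E H K (A : E -> H) (B : E -> K) c :
  0 <= c -> (forall f, nrm (B f) <= c * nrm (A f)) -> dominated A B.
Proof.
move=> c0 hc; exists (c + 1)%:C; first by rewrite ltcR ltr_wpDl.
move=> f; rewrite le_normC; apply: le_trans (hc f) _.
by rewrite ler_wpM2r ?nrm_ge0 // lerDl.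
Qed.

(** For [k] in the domain, put [e = B^* k = A^* h].  Then [f |-> (f, e) e] is
    dominated by both [A] and [B], because [(f, e) = (A f, h) = (B f, k)], so
    singularity forces [e = 0].  Conversely, if [D] is dominated by both, then
    [g |-> (D g, D f)] factors through both [A] and [B], and so defines an
    element [k] of the domain with [(B f, k) = |D f|^2]. *)
Lemma singularP E H K (A : E -> H) (B : E -> K) :
  bounded_op A -> bounded_op B ->
  singular A B <-> forall k, Ddom A B k -> forall f, rip (B f) k = 0.
Proof.
move=> hA hB; split=> [sing k Dk f|sing D bD].
  have [h _ hk] := Dk; pose e := adjoint B k.
  pose D (f : E) := inner f e *: e.
  have lD : linear D.
    by move=> t u v; rewrite /D innerDl innerZl scalerDl scalerA.
  have nD g : nrm (D g) = complex.Re `|inner g e| * nrm e by rewrite nrmZ.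
  have De : D e = 0.
    apply: sing.
    - apply: (@nrm_bounded _ _ _ (nrm e * nrm e)) => // g.
      rewrite nD mulrAC ler_wpM2r ?nrm_ge0 // mulrC; exact: inner_le.
    - apply: (@nrm_dominated _ _ _ _ _ (nrm h * nrm e)).
        by rewrite mulr_ge0 ?nrm_ge0.
      move=> g; rewrite nD mulrAC ler_wpM2r ?nrm_ge0 // mulrC.
      by rewrite /e -hk -adjointP //; apply: inner_le.
    - apply: (@nrm_dominated _ _ _ _ _ (nrm k * nrm e)).
        by rewrite mulr_ge0 ?nrm_ge0.
      move=> g; rewrite nD mulrAC ler_wpM2r ?nrm_ge0 // mulrC.
      by rewrite /e -adjointP //; apply: inner_le.
  suff e0 : e = 0 by rewrite rip_adjoint // -/e e0 rip0r.
  apply/eqP; move/eqP: De; rewrite scaler_eq0 => /orP[|//].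
  rewrite -inner_normE sqrf_eq0 normr_eq0 //.
move=> /dominated_nrm[c hc] /dominated_nrm[c' hc'] f.
have lD := bounded_linear bD.
apply/nrm_eq0/eqP; rewrite -sqrf_eq0 nrm_sq; apply/eqP.
have lphi (t : R) u v : rip (D (t%:C *: u + v)) (D f) =
    t * rip (D u) (D f) + rip (D v) (D f) by rewrite lD !ripE.
have [||h hP] := @douglas _ _ A (fun g => rip (D g) (D f)) (c * nrm (D f)) _ lphi.
- exact: bounded_linear.
- move=> g; apply: le_trans (rip_le _ _) _; rewrite mulrAC.
  by rewrite ler_wpM2r ?nrm_ge0.
have [||k kP] := @douglas _ _ B (fun g => rip (D g) (D f)) (c' * nrm (D f)) _ lphi.
- exact: bounded_linear.
- move=> g; apply: le_trans (rip_le _ _) _; rewrite mulrAC.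
  by rewrite ler_wpM2r ?nrm_ge0.
rewrite kP; apply: sing; apply/DdomP => //.
by exists h => g; rewrite -kP hP.
Qed.

End operators.

(** * The closure of L(A, B) and almost domination *)

Section relation_closure.
Variables (R : realType) (E H K : hilbertType R) (A : E -> H) (B : E -> K).

Lemma RNP v u : RN A B (v, u) <-> forall e : R, 0 < e ->
  exists f, nrm (v - A f) < e /\ nrm (u - B f) < e.
Proof.
split=> [/closure_prodP h e /h[_ [[f _ <-] ? ?]]|h]; first by exists f.
apply/closure_prodP => e /h[f [? ?]]; exists (A f, B f); split => //.
by exists f.
Qed.

Lemma RN_graph f : RN A B (A f, B f).
Proof. by apply: subset_closure; exists f. Qed.

(** A vector orthogonal to [L(A, B)] is orthogonal to its closure, without
    mention of an inner product on [H * K]. *)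
Lemma rip_RN p r v u : (forall f, rip (A f) p + rip (B f) r = 0) ->
  RN A B (v, u) -> rip v p + rip u r = 0.
Proof.
move=> h /RNP vu; apply/eqP; rewrite -normr_le0; apply/ler_addgt0Pr => e e0.
rewrite add0r; have N0 : 0 < 1 + (nrm p + nrm r).
  by rewrite ltr_pwDl // addr_ge0 ?nrm_ge0.
have [f [vf uf]] := vu _ (divr_gt0 e0 N0).
set d := e / _ in vf uf.
have d0 : 0 < d by rewrite divr_gt0.
have -> : e = d * (1 + (nrm p + nrm r)) by rewrite mulfVK ?gt_eqF.
have -> : rip v p + rip u r = rip (v - A f) p + rip (u - B f) r.
  by rewrite !ripE addrACA -opprD h subr0.
apply: le_trans (_ : d * nrm p + d * nrm r <= _); last by nra.
apply: le_trans (ler_normD _ _) _; apply: lerD.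
  apply: (@le_trans _ _ (nrm (v - A f) * nrm p)).
    by rewrite ler_norml rip_le rip_ge.
  by rewrite ler_wpM2r ?nrm_ge0 // ltW.
apply: (@le_trans _ _ (nrm (u - B f) * nrm r)).
  by rewrite ler_norml rip_le rip_ge.
by rewrite ler_wpM2r ?nrm_ge0 // ltW.
Qed.

Hypotheses (lA : linear A) (lB : linear B).

Lemma RN_submod t v u v' u' : RN A B (v, u) -> RN A B (v', u') ->
  RN A B (t *: v + v', t *: u + u').
Proof.
move=> /RNP h /RNP h'; apply/RNP => e e0.
set r := complex.Re `|t|.
have r0 : 0 <= r by rewrite -ler0c RRe_real ?ger0_real.
have d0 : 0 < e / (1 + r) by rewrite divr_gt0 // ltr_pwDl.
have [f [vf uf]] := h _ d0; have [f' [vf' uf']] := h' _ d0.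
have -> : e = r * (e / (1 + r)) + e / (1 + r) by field; rewrite gt_eqF // ltr_pwDl.
exists (t *: f + f'); rewrite lA lB.
split; apply: le_lt_trans (nrm_linear_diff _ _ _ _ _) _; rewrite -/r;
  by apply: ler_ltD => //; rewrite ler_wpM2l // ltW.
Qed.

(** Real form of almost domination.  Monotonicity enters as the bound of
    [|B_n f|] by its limit [|B f|]. *)
Lemma almost_dominated_nrm : almost_dominated A B ->
  exists (Kn : nat -> hilbertType R) (Bn : forall n, E -> Kn n) (c : nat -> R),
  [/\ forall n, linear (Bn n), forall n, 0 <= c n,
      forall n f, nrm (Bn n f) <= c n * nrm (A f),
      forall n f, nrm (Bn n f) <= nrm (B f)
    & forall f e, 0 < e -> exists n, nrm (B f) < nrm (Bn n f) + e].
Proof.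
move=> [Kn [Bn [c [bBn c0 h]]]]; exists Kn, Bn, (fun n => complex.Re (c n)).
have cv f (e : R) : 0 < e -> exists N, forall n, (N <= n)%N ->
    `|nrm (B f) - nrm (Bn n f)| < e.
  move=> e0; have [_ _ /cvgrPdist_lt/(_ (e%:C : R[i]))] := h f.
  rewrite ltcR => /(_ e0) [N _ NP]; exists N => n /NP /=.
  by rewrite !nrmE -rmorphB normc_def /= expr0n addr0 sqrtr_sqr ltcR.
have mono f m n : (m <= n)%N -> nrm (Bn m f) <= nrm (Bn n f).
  move=> /subnK <-; elim: (n - m)%N => [|k IH]; first by rewrite add0n.
  rewrite addSn; apply: le_trans IH _.
  by have [_ /(_ (k + m)%N)] := h f; rewrite !nrmE lecR.
split.
- by move=> n; apply: bounded_linear.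
- by move=> n; have := c0 n; rewrite lecE /= => /andP[].
- by move=> n f; apply: normC_le; have [] := h f.
- move=> n f; apply/ler_addgt0Pr => e e0.
  have [N /(_ (maxn n N) (leq_maxr _ _))] := cv f e e0.
  rewrite ltr_norml => /andP[lo _].
  have := mono f n (maxn n N) (leq_maxl _ _); lra.
- move=> f e e0; have [N /(_ N (leqnn _))] := cv f e e0.
  rewrite ltr_norml => /andP[_ hi]; exists N; lra.
Qed.

(** Let [(0, g)] be a limit of points [(A f', B f')], and fix one such [f] with
    [B f] close to [g].  Then [|B_n f| <= |B (f - f')| + c_n |A f'|], where the
    first term is small and the second one tends to 0 along the limit.  So
    [|B_n f|] is small uniformly in [n], hence so are [|B f|] and [|g|]. *)
Lemma almost_dominated_operator : almost_dominated A B -> is_operator (RN A B).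
Proof.
move=> /almost_dominated_nrm[Kn [Bn [c [lBn c0 Bc BB sup]]]] h g1 g2 h1 h2.
apply/eqP; rewrite -subr_eq0; apply/eqP; set g := g1 - g2.
have /RNP {}hg : RN A B (0, g).
  have := @RN_submod (-1) _ _ _ _ h2 h1; rewrite !scaleN1r addNr.
  by rewrite addrC -/g.
apply/nrm_eq0/le_anti/andP; split; last exact: nrm_ge0.
apply/ler_addgt0Pr => e e0; rewrite add0r.
have e4 : 0 < e / 4 by rewrite divr_gt0.
have [f [_ gf]] := hg _ e4; have [n nf] := sup f _ e4.
have d0 : 0 < e / 4 / (1 + c n) by rewrite divr_gt0 // ltr_pwDl.
have [f' [Af' gf']] := hg _ d0.
have {}Af' : nrm (A f') < e / 4 / (1 + c n) by rewrite -nrmN -sub0r.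
have h3 : nrm (Bn n f) <= nrm (Bn n (f - f')) + nrm (Bn n f').
  by have := nrmD (Bn n f - Bn n f') (Bn n f'); rewrite subrK -(linB f f' (lBn n)).
have h4 : nrm (Bn n (f - f')) <= nrm (g - B f) + nrm (g - B f').
  apply: le_trans (BB _ _) _; rewrite linB // (nrmBC g (B f)).
  exact: nrm_triangle.
have h5 : nrm (Bn n f') <= c n * (e / 4 / (1 + c n)).
  by apply: le_trans (Bc _ _) _; rewrite ler_wpM2l // ltW.
(* [f'] is taken so close that its error and [c_n] times it sum to [e / 4]. *)
have h6 : c n * (e / 4 / (1 + c n)) + e / 4 / (1 + c n) = e / 4.
  by field; rewrite gt_eqF // ltr_pwDl.
have h7 : nrm g <= nrm (g - B f) + nrm (B f).
  by have := nrmD (g - B f) (B f); rewrite subrK.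
lra.
Qed.

(** Let [(v, u)] be the projection of [(0, x)] onto the closure of [L(A, B)].
    Orthogonality of [(- v, x - u)] to [L(A, B)] says that [x - u] lies in the
    domain.  If [x] is orthogonal to the domain, Pythagoras then gives
    [v = 0] and [u = x]; so [(0, x)] itself lies in the closure. *)
Lemma operator_domain_total x : is_operator (RN A B) ->
  (forall k, (exists h, forall f, rip (B f) k = rip (A f) h) -> rip k x = 0) ->
  x = 0.
Proof.
move=> op hx.
have [] := @riesz R E H K setT A B (fun f => rip (B f) x) (nrm x) (submodT _) lA lB.
- by move=> t u v; rewrite lB !ripE.
- move=> f _; apply: le_trans (rip_le _ _) _; rewrite mulrC.
  by rewrite ler_wpM2l ?nrm_ge0 // lerDr nrm_ge0.
move=> v [u [vu hP]].
have RNvu : RN A B (v, u).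
  by apply/RNP => e /vu[f [_ ? ?]]; exists f; split; rewrite nrmBC.
have ux : rip (x - u) x = 0.
  by apply: hx; exists v => f; rewrite !ripE hP // addrK.
have uv : rip v v + rip u (u - x) = 0.
  by apply: rip_RN RNvu => f; rewrite ripDr ripNr hP //; ring.
have : nrm (x - u) ^+ 2 + nrm v ^+ 2 = 0.
  by move: ux uv; rewrite !nrm_sq !ripE (ripC x u) => *; lra.
move/eqP; rewrite paddr_eq0 ?sqr_ge0 // !sqrf_eq0 => /andP[/eqP xu /eqP v0].
move/nrm_eq0/eqP: xu; rewrite subr_eq0 => /eqP xu.
rewrite (nrm_eq0 v0) -xu in RNvu.
apply: op RNvu _; rewrite -(lin0 lA) -[X in RN _ _ (_, X)](lin0 lB).
exact: RN_graph.
Qed.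

(** The Euler equation of the problem of minimising [|u|^2 + s^2 |A f - v|^2]
    over the closure of [L(A, B)].  If [T] denotes that closure, then
    [u = (I + s^-2 T T^* )^-1 B f] in the sense of relations: a resolvent
    applied to [B f]. *)
Definition approximant (s : R) f u := exists2 v, RN A B (v, u) &
  forall g, inner (A g) ((s ^+ 2)%:C *: (A f - v)) = inner (B g) u.

(** Represent [g |-> (s A g, s A f)] on the closure of [L(s A, B)].  Assuming
    [1 <= s], dividing the first component by [s] does not spoil the
    approximation. *)
Lemma approximant_ex s f : 1 <= s -> exists u, approximant s f u.
Proof.
move=> s1; have s0 : 0 < s by apply: lt_le_trans s1.
have [] := @riesz R E H K setT (fun g => s%:C *: A g) B
  (fun g => rip (s%:C *: A g) (s%:C *: A f)) (nrm (s%:C *: A f)) (submodT _) _ lB.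
- by move=> t u v; rewrite lA scalerDr !scalerA mulrC.
- by move=> t u v; rewrite lA !ripE; ring.
- move=> v _; apply: le_trans (rip_le _ _) _; rewrite mulrC.
  by rewrite ler_wpM2l ?nrm_ge0 // lerDl nrm_ge0.
move=> w [u [wu hP]]; exists u, (s^-1%:C *: w).
  apply/RNP => e e0; have [g [_ gw gu]] := wu e e0; exists g.
  split; last by rewrite nrmBC.
  have -> : A g = s^-1%:C *: (s%:C *: A g).
    by rewrite scalerA -rmorphM mulVf ?gt_eqF // scale1r.
  rewrite -scalerBr nrmZr nrmBC gtr0_norm ?invr_gt0 //.
  rewrite mulrC ltr_pdivrMr //; apply: lt_le_trans gw _.
  by rewrite ler_peMr // ltW.
move=> g.
apply: (@rip_inner _ _ _ _ setT A B) => // [|{}g _]; first exact: submodT.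
have := hP g I; rewrite !ripE => h.
have -> : rip (B g) u = s * (s * rip (A g) (A f)) - s * rip (A g) w by lra.
by field; rewrite gt_eqF.
Qed.

End relation_closure.

(** * Dense domain implies almost domination *)

Section regularization.
Variables (R : realType) (E H K : hilbertType R) (A : E -> H) (B : E -> K).
Hypotheses (lA : linear A) (lB : linear B).

Lemma approximantP s f u : approximant A B s f u ->
  exists2 v, RN A B (v, u) &
    forall v' u', RN A B (v', u') -> s ^+ 2 * rip v' (A f - v) = rip u' u.
Proof.
move=> [v vu hP]; exists v => // v' u' vu'.
have : rip v' ((s ^+ 2)%:C *: (A f - v)) + rip u' (- u) = 0.
  by apply: rip_RN vu' => g; rewrite ripNr /rip hP subrr.
by rewrite ripZr ripNr => /eqP; rewrite subr_eq0 => /eqP.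
Qed.

Lemma approximant_linear s t f f' u u' :
  approximant A B s f u -> approximant A B s f' u' ->
  approximant A B s (t *: f + f') (t *: u + u').
Proof.
move=> [v vu hP] [v' vu' hP']; exists (t *: v + v'); first exact: RN_submod.
move=> g.
have -> : A (t *: f + f') - (t *: v + v') = t *: (A f - v) + (A f' - v').
  by rewrite lA opprD addrACA -scalerBr.
rewrite scalerDr scalerA [_ * t]mulrC -scalerA.
by rewrite !innerDr !(innerZr t) hP hP'.
Qed.

(** Testing the Euler equation with [(v, u)] and with [(A f, B f)] gives
    [|u|^2 + s^2 |A f - v|^2 = s^2 (A f, A f - v) = (B f, u)];
    the bounds follow by Cauchy-Schwarz. *)
Lemma approximant_bounds s f u : 0 < s -> approximant A B s f u ->
  exists v, [/\ RN A B (v, u), s * nrm (A f - v) <= nrm (B f),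
    nrm u <= s * nrm (A f) & nrm u <= nrm (B f)].
Proof.
move=> s0 /approximantP[v vu hP]; exists v.
have h1 := hP _ _ vu; have h2 := hP _ _ (@RN_graph _ _ _ _ A B f).
have h3 : rip v (A f - v) = rip (A f) (A f - v) - rip (A f - v) (A f - v).
  by rewrite [in RHS]ripDl ripNl; ring.
rewrite h3 -!nrm_sq in h1.
have h4 := rip_le (A f) (A f - v); have h5 := rip_le (B f) u.
move: h1 h2 h4 h5 (nrm_ge0 (A f)) (nrm_ge0 (A f - v)) (nrm_ge0 (B f)) (nrm_ge0 u).
move: (rip (A f) (A f - v)) (rip (B f) u) (nrm (A f)) (nrm (A f - v)) (nrm (B f)) (nrm u).
move=> x y a r b n h1 h2 h4 h5 a0 r0 b0 n0.
have e1 : n ^+ 2 + (s * r) ^+ 2 = y by rewrite -h2 -h1; ring.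
have h6 : n <= b.
  rewrite leNgt; apply/negP => bn; have := sqr_ge0 (s * r); nra.
split => //.
  have sr0 : 0 <= s * r by rewrite mulr_ge0 // ltW.
  rewrite leNgt; apply/negP => bn; nra.
have sa : 0 <= s * a by rewrite mulr_ge0 // ltW.
have e2 : n ^+ 2 <= (s * a) * (s * r).
  have -> : (s * a) * (s * r) = s ^+ 2 * (a * r) by ring.
  rewrite -h1 ler_wpM2l ?sqr_ge0 //; have := sqr_ge0 r; lra.
have e3 : n ^+ 2 + (s * r) ^+ 2 <= (s * a) * (s * r).
  have -> : (s * a) * (s * r) = s ^+ 2 * (a * r) by ring.
  by rewrite e1 -h2 ler_wpM2l ?sqr_ge0.
move: (s * r) (s * a) sa e2 e3 => p q q0 e2 e3.
rewrite leNgt; apply/negP => qn.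
have := sqr_ge0 (p - q); have := sqr_ge0 p; nra.
Qed.

Lemma approximant_uniq s f u u' : 0 < s ->
  approximant A B s f u -> approximant A B s f u' -> u = u'.
Proof.
move=> s0 h h'; have := approximant_linear (-1) h' h.
rewrite !scaleN1r [- f + f]addNr => /(approximant_bounds s0)[v [_ _ + _]].
rewrite lin0 // nrm0 mulr0 => n0; apply/eqP; rewrite -subr_eq0 addrC.
by apply/eqP/nrm_eq0/le_anti; rewrite n0 nrm_ge0.
Qed.

(** With [r = A f - v] and [r' = A f - v'], testing both Euler equations with
    [(v - v', u - u')] and adding shows
    [(s^2 + s'^2) (r, r') >= s^2 |r|^2 + s'^2 |r'|^2].  This forces
    [|r'| <= |r|], whence [|u|^2 - (u, u') = s^2 ((r, r') - |r|^2) <= 0]. *)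
Lemma approximant_mono s s' f u u' : 0 < s -> s <= s' ->
  approximant A B s f u -> approximant A B s' f u' -> nrm u <= nrm u'.
Proof.
move=> s0 ss' /approximantP[v vu hP] /approximantP[v' vu' hP'].
have := hP _ _ vu; have := hP _ _ vu'; have := hP' _ _ vu; have := hP' _ _ vu'.
have rv : v = A f - (A f - v) by rewrite opprB addrC subrK.
have rv' : v' = A f - (A f - v') by rewrite opprB addrC subrK.
set r := A f - v in rv *; set r' := A f - v' in rv' *.
rewrite rv rv' !ripDl !ripNl (ripC r' r) (ripC u' u) => e1 e2 e3 e4.
have := rip_le r r'; have := rip_le u u'.
move: e1 e2 e3 e4; rewrite -!nrm_sq.
move: (nrm_ge0 u) (nrm_ge0 u') (nrm_ge0 r) (nrm_ge0 r').
have s0' : 0 < s' by apply: lt_le_trans ss'.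
have : 0 < s ^+ 2 by rewrite exprn_gt0.
have : s ^+ 2 <= s' ^+ 2 by rewrite lerXn2r ?nnegrE // ltW.
move: (s ^+ 2) (s' ^+ 2) (nrm u) (nrm u') (nrm r) (nrm r').
move: (rip r r') (rip (A f) r) (rip (A f) r') (rip u u').
move=> rr x x' uu a b n n' p p' ab a0 n0 n0' p0 p0' e1 e2 e3 e4 huu hrr.
have f1 : n ^+ 2 = uu + a * rr - a * p ^+ 2 by lra.
have f2 : n' ^+ 2 = uu + b * rr - b * p' ^+ 2 by lra.
have f3 : 0 <= (a + b) * (p * p') - a * p ^+ 2 - b * p' ^+ 2.
  have : (a + b) * rr <= (a + b) * (p * p').
    by rewrite ler_wpM2l // addr_ge0 ?ltW // (lt_le_trans a0).
  have : 2 * uu <= n ^+ 2 + n' ^+ 2 by have := sqr_ge0 (n - n'); nra.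
  lra.
have f4 : p' <= p.
  rewrite leNgt; apply/negP => pp.
  have g1 : 0 <= (p - p') * (b * p' - a * p) by move: f3; lra.
  have g2 : a * p < a * p' by rewrite ltr_pM2l.
  have g3 : a * p' <= b * p' by rewrite ler_wpM2r.
  have g4 : 0 < b * p' - a * p by lra.
  by nra.
have f5 : a * rr <= a * p ^+ 2.
  apply: ler_wpM2l; first exact: ltW.
  by apply: le_trans hrr _; rewrite expr2 ler_wpM2l.
have f6 : n ^+ 2 <= n * n' by lra.
by rewrite leNgt; apply/negP => nn; nra.
Qed.

Hypothesis dense : closure
  [set k | exists h, forall f, rip (B f) k = rip (A f) h] = setT.

(** For [k] in the domain, with [(B g, k) = (A g, h)] for all [g], the Euler
    equation gives [(B f - u, k) = (A f - v, h)], and this is at most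
    [|B f| |h| / s].  Choosing [k] close to [B f] bounds
    [|B f|^2 - (u, B f)], and hence [|B f| - |u|]. *)
Lemma approximant_cvg f (e : R) : 0 < e -> exists N : nat,
  forall (n : nat) u, (N <= n)%N -> approximant A B n.+1%:R f u ->
  nrm (B f) < nrm u + e.
Proof.
move=> e0; have [b0|bn0] := eqVneq (nrm (B f)) 0.
  by exists 0%N => n u _ _; rewrite b0 ltr_wpDl ?nrm_ge0.
have bp : 0 < nrm (B f) by rewrite lt_neqAle eq_sym bn0 nrm_ge0.
have e4 : 0 < e / 4 by rewrite divr_gt0.
have /closureP/(_ _ e4)[k [h hk] Bk] : closure
  [set k | exists h, forall f, rip (B f) k = rip (A f) h] (B f) by rewrite dense.
have d0 : 0 < e / 4 / (1 + nrm h) by rewrite divr_gt0 // ltr_pwDl ?nrm_ge0.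
have [N _ NP] := near_infty_natSinv_lt (PosNum d0).
exists N => n u Nn /(approximant_bounds (ltr0Sn _ n))[v [vu vb _ ub]].
have s0 : 0 < n.+1%:R :> R by rewrite ltr0Sn.
have {}NP : n.+1%:R^-1 < e / 4 / (1 + nrm h) := NP n Nn.
have uk : rip v h + rip u (- k) = 0.
  by apply: rip_RN vu => g; rewrite ripNr hk subrr.
have h1 : rip (B f - u) k = rip (A f - v) h.
  by rewrite !ripDl !ripNl hk; rewrite ripNr in uk; lra.
have h2 : rip (A f - v) h <= nrm (B f) * (e / 4).
  apply: le_trans (rip_le _ _) _.
  have r1 : nrm (A f - v) <= nrm (B f) * n.+1%:R^-1 by rewrite ler_pdivlMr // mulrC.
  have r2 : n.+1%:R^-1 * nrm h <= e / 4.
    apply: (@le_trans _ _ (e / 4 / (1 + nrm h) * nrm h)).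
      by rewrite ler_wpM2r ?nrm_ge0 // ltW.
    rewrite -[leRHS](@mulfVK _ (1 + nrm h)) ?gt_eqF ?ltr_pwDl ?nrm_ge0 //.
    by rewrite ler_wpM2l ?(ltW d0) // lerDr.
  apply: le_trans (_ : nrm (B f) * n.+1%:R^-1 * nrm h <= _).
    by rewrite ler_wpM2r ?nrm_ge0.
  by rewrite -mulrA ler_wpM2l ?nrm_ge0.
have h3 : rip (B f - u) (B f - k) <= 2 * nrm (B f) * (e / 4).
  apply: le_trans (rip_le _ _) _; apply: ler_pM; rewrite ?nrm_ge0 ?(ltW Bk) //.
  by have := nrmD (B f) (- u); rewrite nrmN; lra.
have h4 : rip (B f - u) (B f) = rip (B f - u) k + rip (B f - u) (B f - k).
  by rewrite ripDr ripNr; ring.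
have h5 := rip_le u (B f).
move: h4; rewrite ripDl ripNl -nrm_sq h1 => h4.
rewrite -(ltr_pM2l bp).
by move: (mulr_gt0 bp e0) => ?; lra.
Qed.

Lemma dense_almost_dominated : bounded_op B -> almost_dominated A B.
Proof.
move=> /bounded_nrm[cB hB].
have s1 (n : nat) : 1 <= n.+1%:R :> R by rewrite ler1n.
have s0 (n : nat) : 0 < n.+1%:R :> R by rewrite ltr0Sn.
have /choice[Bn BnP] : forall n : nat, exists T : E -> K,
    forall f, approximant A B n.+1%:R f (T f).
  move=> n; have /choice[T TP] := fun f => approximant_ex lA lB f (s1 n).
  by exists T.
have lBn n : linear (Bn n).
  move=> t f f'; apply: (approximant_uniq (s0 n) (BnP n _)).
  exact: approximant_linear.
have bd n f := approximant_bounds (s0 n) (BnP n f).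
exists (fun=> K), Bn, (fun n => n.+1%:R%:C); split=> [n|n|f].
- apply: (@nrm_bounded _ _ _ _ cB) => // f.
  by have [v [_ _ _ ub]] := bd n f; apply: le_trans ub _.
- by rewrite ler0c ltW.
split=> [n|n|].
- by rewrite le_normC; have [v []] := bd n f.
- by rewrite !nrmE lecR; apply: approximant_mono (BnP n f) (BnP n.+1 f);
    rewrite ?ler_nat.
apply/cvgrPdist_lt => _ /epsC[e e0 ->].
have [N NP] := approximant_cvg f e0; exists N => // n Nn /=.
rewrite !nrmE -rmorphB normc_def /= expr0n addr0 sqrtr_sqr ltcR.
have := NP n _ Nn (BnP n f); have [v [_ _ _ ub]] := bd n f => hlt.
by rewrite ger0_norm ?subr_ge0 // ltrBlDl.
Qed.

End regularization.

(** * Admissible subspaces *)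

Section admissible_subspaces.
Variables (R : realType) (K : hilbertType R).
Implicit Types S M L D : set K.

Lemma orthoproj_proj M : (forall k, exists2 m, M m & orthocompl M (k - m)) ->
  is_proj M (orthoproj M).
Proof.
move=> h k; have [m Mm om] := h k.
by have := xgetI (0 : K) (conj Mm om : [set m | M m /\ orthocompl M (k - m)] m).
Qed.

Lemma rip_ortho S s x : S s -> orthocompl S x -> rip s x = 0.
Proof. by move=> Ss h; rewrite ripC /rip h. Qed.

Lemma orthocompl_closure S x y : submod_closed (mem S) ->
  closure S y -> orthocompl S x -> rip y x = 0.
Proof. by move=> sS cy ox; apply: rip_closure cy => s Ss; apply: rip_ortho ox. Qed.

Lemma bi_orthocompl S x : submod_closed (mem S) ->
  (forall y, orthocompl S y -> rip y x = 0) -> closure S x.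
Proof.
move=> sS h; have [m cm om] := projection_ex x sS.
suff : x - m = 0 by move/eqP; rewrite subr_eq0 => /eqP ->.
apply/nrm_eq0/eqP; rewrite -sqrf_eq0 nrm_sq ripDr ripNr h //.
by rewrite ripC (orthocompl_closure sS cm om) subrr.
Qed.

Lemma submodI S M : submod_closed (mem S) -> submod_closed (mem M) ->
  submod_closed (mem (S `&` M)).
Proof.
move=> /submodP[S0 Sl] /submodP[M0 Ml]; apply/submodP; split => // t u v [? ?] [? ?].
by split; [apply: Sl|apply: Ml].
Qed.

Lemma submodB S u v : submod_closed (mem S) -> S u -> S v -> S (u - v).
Proof.
by move=> /submodP[S0 Sl] Su Sv; rewrite -[u - v]addrC -scaleN1r; apply: Sl.
Qed.

Lemma rip_xx0 (x : K) : rip x x = 0 -> x = 0.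
Proof. by move=> h; apply/nrm_eq0/eqP; rewrite -sqrf_eq0 nrm_sq h. Qed.

(** For the projection [P] onto [M], the first condition says that [P B] is
    singular, the second that [(I - P) B] is almost dominated; density of
    [M^\perp \cap D] in [M^\perp] is stated as triviality of its orthogonal
    complement there. *)
Definition splits D M := M `&` D `<=` [set 0] /\
  forall x, orthocompl M x ->
    (forall y, orthocompl M y -> D y -> rip y x = 0) -> x = 0.

(** Admissibility involves [A] and [B] only through the subspace [D]; the
    correspondence between [L] and [M] is geometry of an arbitrary subspace. *)
Definition admissible_for D L : Prop :=
  [/\ closed_subspace L, L `<=` closure D, L `&` D = [set 0]
    & closure (orthocompl L `&` D) = orthocompl L `&` closure D].

Section admissible.
Variables D L : set K.
Hypotheses (sD : submod_closed (mem D)) (adm : admissible_for D L).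
Let M := sum_set (orthocompl D) L.

Lemma sum_set_submod : submod_closed (mem M).
Proof.
have [[/submodP[L0 Ll] _] _ _ _] := adm.
have /submodP[Z0 Zl] := orthocompl_submod D.
apply/submodP; split; first by exists 0, 0; rewrite addr0.
move=> t _ _ [x [l [ox Ll' ->]]] [x' [l' [ox' Ll'' ->]]].
exists (t *: x + x'), (t *: l + l').
by split; [exact: Zl|exact: Ll|rewrite scalerDr addrACA].
Qed.

(** The two summands are orthogonal, as [L] lies in the closure of [D], so the
    projections onto them add up. *)
Lemma sum_set_proj : is_proj M (orthoproj M).
Proof.
have [[sL cL] LD _ _] := adm.
have sO := orthocompl_submod D.
apply: orthoproj_proj => k.
have [p] := projection_ex k sO.
rewrite -(closure_id _).1; last exact: orthocompl_closed.
move=> op kp; have [l] := projection_ex k sL; rewrite -(closure_id _).1 // => Ll kl.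
exists (p + l); first by exists p, l.
apply/orthocomplP; first exact: sum_set_submod.
move=> _ [x [l' [ox Ll' ->]]].
have e1 := rip_ortho ox kp; have e2 := rip_ortho Ll' kl.
have e3 := orthocompl_closure sD (LD _ Ll) ox.
have e4 := orthocompl_closure sD (LD _ Ll') op.
move: e1 e2 e3 e4; rewrite !ripE (ripC l x) => *; lra.
Qed.

(** A vector orthogonal to [M] is orthogonal to [L] and lies in
    [clos D = D^\perp^\perp]; by admissibility [L^\perp \cap D], which equals
    [M^\perp \cap D], comes arbitrarily close to it. *)
Lemma sum_set_splits : splits D M.
Proof.
have [[sL cL] LD LD0 LC] := adm; split.
  move=> _ [[x [l [ox Ll ->]]] Dk].
  have xl : rip x l = 0 by rewrite ripC; apply: orthocompl_closure ox => //; apply: LD.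
  have xk := rip_ortho Dk ox.
  have x0 : x = 0 by apply: rip_xx0; move: xk; rewrite ripC ripDr xl addr0.
  move: Dk; rewrite x0 add0r => Dl.
  by have : (L `&` D) l by []; rewrite LD0.
move=> x ox h.
have xL : orthocompl L x.
  move=> l Ll; apply: ox; exists 0, l; rewrite add0r; split => //.
  by have /submodP[] := orthocompl_submod D.
have xD : closure D x.
  apply: bi_orthocompl => // y oy; rewrite ripC /rip ox //.
  exists y, 0; rewrite addr0; split => //.
  by have /submodP[] := sL.
have : closure (orthocompl L `&` D) x by rewrite LC.
move=> /(rip_closure _) cx; apply: rip_xx0; apply: cx => s [oLs Ds].
apply: h => //; apply/orthocomplP; first exact: sum_set_submod.
move=> _ [y [l [oy Ll ->]]].
by rewrite ripDl (rip_ortho Ll oLs) addr0 ripC (rip_ortho Ds oy).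
Qed.

(** The correspondence between [L] and [M] loses no information. *)
Lemma sum_setI : M `&` closure D = L.
Proof.
have [[sL cL] LD LD0 LC] := adm; apply/seteqP; split.
  move=> _ [[x [l [ox Ll ->]]] Dk].
  have xl : rip x l = 0 by rewrite ripC; apply: orthocompl_closure ox => //; apply: LD.
  have := orthocompl_closure sD Dk ox; rewrite ripDl (ripC l) xl addr0.
  by move=> /rip_xx0 ->; rewrite add0r.
move=> l Ll; split; last exact: LD.
exists 0, l; rewrite add0r; split => //.
by have /submodP[] := orthocompl_submod D.
Qed.

End admissible.

Section splits.
Variables D M : set K.
Hypotheses (sD : submod_closed (mem D)) (sM : submod_closed (mem M)).
Hypotheses (cM : closed M) (DM : splits D M).

(* A vector orthogonal to [D] differs from its projection onto [M] by a vector
   of [M^\perp] that is orthogonal to [M^\perp \cap D]. *)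
Let orthoD_sub : orthocompl D `<=` M.
Proof.
move=> x ox; have [m] := projection_ex x sM; rewrite -(closure_id _).1 // => Mm om.
suff : x - m = 0 by move/eqP; rewrite subr_eq0 => /eqP ->.
apply: DM.2 => // z oz Dz; rewrite ripDr ripNr (rip_ortho Dz ox).
by rewrite ripC (rip_ortho Mm oz) subrr.
Qed.

Let L := M `&` closure D.

(** For [m] in [M], its component in [D^\perp] already lies in [M]; hence so
    does its component in [clos D]. *)
Lemma splits_sum_set : sum_set (orthocompl D) L = M.
Proof.
apply/seteqP; split.
  move=> _ [x [l [/orthoD_sub Mx [Ml _] ->]]].
  by have /submodP[_ h] := sM; rewrite -[x]scale1r; apply: h.
move=> m Mm; have [d cd od] := projection_ex m sD.
exists (m - d), d; split => //; last by rewrite subrK.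
split => //; have -> : d = m - (m - d) by rewrite opprB addrC subrK.
by apply: submodB => //; apply: orthoD_sub.
Qed.

(** The density condition: a vector of [L^\perp \cap clos D] is orthogonal to
    [D^\perp] as well as to [L], hence to [M], where [splits] applies. *)
Lemma splits_admissible : admissible_for D L.
Proof.
have sc := closure_submod sD.
have sL := submodI sM sc.
have sO := orthocompl_submod M.
have LM : orthocompl M `<=` orthocompl L.
  by move=> x ox l [Ml _]; apply: ox.
split.
- by split => //; apply: closedI => //; apply: closed_closure.
- by move=> x [].
- apply/seteqP; split=> [x [[Mx _] Dx]|_ ->]; first exact: DM.1.
  by split; [have /submodP[] := sL|have /submodP[] := sD].
- apply/seteqP; split=> x.
    move=> cx; split.
      rewrite [orthocompl L](closure_id _).1; last exact: orthocompl_closed.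
      by apply: closure_subset cx => y [].
    by apply: closure_subset cx => y [].
  move=> [oLx cx].
  have oMx : orthocompl M x.
    apply/orthocomplP => //; rewrite -splits_sum_set => _ [y [l [oy Ll ->]]].
    by rewrite ripDl (rip_ortho Ll oLx) addr0 ripC (orthocompl_closure sD cx oy).
  have [m cm om] := projection_ex x (submodI sO sD).
  have oMm : orthocompl M m.
    rewrite [orthocompl M](closure_id _).1; last exact: orthocompl_closed.
    by apply: closure_subset cm => y [].
  suff : x - m = 0.
    move/eqP; rewrite subr_eq0 => /eqP ->.
    by apply: closure_subset cm => y [/LM].
  apply: DM.2; first exact: (submodB sO oMx oMm).
  by move=> y oy Dy; apply: (rip_ortho (conj oy Dy) om).
Qed.

End splits.
End admissible_subspaces.

(** * From subspaces to decompositions and back *)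

Section decomposition.
Variables (R : realType) (E H K : hilbertType R) (A : E -> H) (B : E -> K).
Hypotheses (hA : bounded_op A) (hB : bounded_op B).
Let D := Ddom A B.
Let sD : submod_closed (mem D) := Ddom_submod hA hB.
Let lA : linear A := bounded_linear hA.
Let lB : linear B := bounded_linear hB.

(** Since [(P B f, k) = (B f, P k)], a vector [k] lies in [D(A, P B)] iff [P k]
    lies in [D], so that [M \cap D = 0] makes [P B] singular.  In the same way
    [D(A, (I - P) B)] contains [M] and [M^\perp \cap D]; a vector orthogonal to
    both is 0. *)
Lemma splits_decomposition (M : set K) (P : K -> K) :
  submod_closed (mem M) -> is_proj M P -> splits D M ->
  lebesgue_decomposition A B ((fun k => k - P k) \o B, P \o B).
Proof.
move=> sM PP [MD0 Mdense].
have lP := proj_linear sM PP.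
have lB1 : linear ((fun k => k - P k) \o B).
  by move=> t u v /=; rewrite lB lP opprD addrACA -scalerBr.
have lB2 : linear (P \o B) by move=> t u v /=; rewrite lB lP.
have [c hc] := bounded_nrm hB.
have bB1 : bounded_op ((fun k => k - P k) \o B).
  by apply: (@nrm_bounded _ _ _ _ c) => // f; apply: le_trans (projC_bound PP _) _.
have bB2 : bounded_op (P \o B).
  by apply: (@nrm_bounded _ _ _ _ c) => // f; apply: le_trans (proj_bound PP _) _.
split=> //.
- by move=> f; rewrite /= subrK.
- by move=> f g; have [_ +] := PP (B f); apply; have [] := PP (B g).
- apply: dense_almost_dominated => //.
  set S := [set k | _].
  have SE : S = Ddom A ((fun k => k - P k) \o B).
    by apply/seteqP; split=> k /DdomP h; apply/h.
  rewrite SE; apply: closure_orthocompl0; first exact: Ddom_submod.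
  rewrite -SE => x ox.
  have MS k : M k -> S k.
    move=> Mk; exists 0 => f /=; rewrite rip0r ripC.
    by apply: rip_ortho Mk _; have [] := PP (B f).
  apply: Mdense; first by apply/orthocomplP => // s /MS Ss; apply: rip_ortho ox.
  move=> y oy /(DdomP hA hB)[h hy]; apply: rip_ortho ox; exists h => f /=.
  rewrite -hy ripDl ripNl (rip_ortho (PP (B f)).1 oy) subr0 //.
- apply/singularP => // k /(DdomP hA bB2)[h hk] f.
  suff Pk0 : P k = 0 by rewrite /= (proj_sym PP) Pk0 rip0r.
  apply: MD0; split; first by have [] := PP k.
  by apply/DdomP => //; exists h => g; rewrite -hk /= (proj_sym PP).
Qed.

(** Orthogonality of the ranges makes [P B = B2] for the projection [P] onto
    [M = clos ran B2].  On [M] the functionals of [B] and [B2] agree, and on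
    [M^\perp] those of [B] and [B1]; so the two conditions of [splits] follow
    from singularity of [B2] and density of [D(A, B1)]. *)
Lemma decomposition_splits (B1 B2 : E -> K) :
  lebesgue_decomposition A B (B1, B2) ->
  splits D (closure (range B2)) /\
  forall P, is_proj (closure (range B2)) P -> forall f, P (B f) = B2 f.
Proof.
move=> [[bB1 bB2] BE B12 ad sing].
have lB1 := bounded_linear bB1; have lB2 := bounded_linear bB2.
set M := closure _.
have sR : submod_closed (mem (range B2)).
  apply/submodP; split; first by exists 0 => //; rewrite lin0.
  by move=> t _ _ [u _ <-] [v _ <-]; exists (t *: u + v) => //; rewrite lB2.
have sM : submod_closed (mem M) := closure_submod sR.
have oB1 f : orthocompl M (B1 f).
  apply/orthocomplP => // s; apply: rip_closure => _ [g _ <-].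
  by rewrite ripC /rip B12.
have MB2 f : M (B2 f) by apply: subset_closure; exists f.
have cMM : closure M = M by apply/esym/closure_id; apply: closed_closure.
have [P PP] : exists P, is_proj M P.
  exists (orthoproj M); apply: orthoproj_proj => k.
  by have [m] := projection_ex k sM; rewrite cMM; exists m.
split; last first.
  move=> Q QP f; apply: (proj_eq sM QP); first exact: MB2.
  by rewrite BE addrK.
split.
  move=> k [Mk /(DdomP hA hB)[h hk]] /=.
  have kB1 f : rip (B1 f) k = 0 by rewrite ripC (rip_ortho Mk (oB1 f)).
  have B2k : forall f, rip (B2 f) k = 0.
    apply: (singularP hA bB2).1 => //; apply/DdomP => //; exists h => f.
    by rewrite -hk BE ripDl kB1 add0r.
  by apply: rip_xx0; apply: rip_closure Mk => _ [f _ <-].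
move=> x ox hx.
apply: (operator_domain_total lA lB1); first exact: almost_dominated_operator.
move=> k [h hk]; have [MP oP] := PP k.
rewrite -[k](subrK (P k)) ripDl (rip_ortho MP ox) addr0.
apply: hx => //; apply/DdomP => //; exists h => f.
rewrite -hk BE ripDl (rip_ortho (MB2 f) oP) addr0 ripDr ripNr.
by rewrite (ripC _ (P k)) (rip_ortho MP (oB1 f)) subr0.
Qed.

(** [P] and [P'] agree on [ran B] only, which need not be dense; what is missing
    is orthogonal to [ran B], hence lies in [D], which meets neither [M] nor
    [M'] outside 0. *)
Lemma proj_comp_inj (M M' : set K) (P P' : K -> K) :
  submod_closed (mem M) -> submod_closed (mem M') ->
  is_proj M P -> is_proj M' P' ->
  M `&` D `<=` [set 0] -> M' `&` D `<=` [set 0] ->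
  P \o B = P' \o B -> M = M'.
Proof.
move=> sM sM' PP PP' MD MD' PB.
have {}PB f : P (B f) = P' (B f) by move: (congr1 (@^~ f) PB).
have ND n : (forall f, rip (B f) n = 0) -> D n.
  by move=> h; apply/DdomP => //; exists 0 => f; rewrite h rip0r.
have PE k : P k = P' k.
  apply/eqP; rewrite -subr_eq0; apply/eqP; set n := P k - P' k.
  have Pn f : rip (B f) (P n) = 0.
    have e1 : rip (P (B f)) (P k) = rip (P (B f)) k.
      by rewrite -(proj_sym PP) (proj_id sM PP) //; have [] := PP (B f).
    have e2 : rip (P' (B f)) (P' k) = rip (P' (B f)) k.
      by rewrite -(proj_sym PP') (proj_id sM' PP') //; have [] := PP' (B f).
    by rewrite -(proj_sym PP) /n ripDr ripNr e1 PB e2 subrr.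
  have Pn' f : rip (B f) (P' n) = 0.
    by rewrite -(proj_sym PP') -PB (proj_sym PP).
  have n0 : P n = 0.
    by apply: MD; split; [have [] := PP n|exact: ND].
  have n0' : P' n = 0.
    by apply: MD'; split; [have [] := PP' n|exact: ND].
  apply: rip_xx0; rewrite {2}/n ripDr ripNr -(proj_sym PP) -(proj_sym PP').
  by rewrite n0 n0' !rip0l subrr.
apply/seteqP; split=> x Mx.
  by rewrite -(proj_id sM PP Mx) PE; have [] := PP' x.
by rewrite -(proj_id sM' PP' Mx) -PE; have [] := PP x.
Qed.

End decomposition.

Theorem theorem8p4 (R : realType) (E H K : hilbertType R)
    (A : E -> H) (B : E -> K) (hA : bounded_op A) (hB : bounded_op B) :
  let B1 := fun L : set K => PMc A B L \o B in
  let B2 := fun L : set K => PM A B L \o B in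
  set_bij [set L | admissible A B L]
          [set B12 | lebesgue_decomposition A B B12]
          (fun L => (B1 L, B2 L)) /\
  forall L : set K, admissible A B L ->
    [/\ is_operator (RN A (B1 L)),
        graph (B1 L) = rel_comp (RN A (B1 L)) (graph A)
      & forall T1 T2 : set (H * K),
          linear_relation T1 -> linear_relation T2 ->
          [/\ T1 = op_rel (PMc A B L) (Lrel A B),
              T2 = op_rel (PM A B L) (Lrel A B)
            & Lrel A B = rel_sum T1 T2] <->
          (T1 = Lrel A (B1 L) /\ T2 = Lrel A (B2 L))].
Proof.
move=> B1 B2; have sD := Ddom_submod hA hB.
have dec L : admissible A B L -> lebesgue_decomposition A B (B1 L, B2 L).
  move=> adm; apply: (splits_decomposition hA hB _ (sum_set_proj sD adm)).
    exact: sum_set_submod adm.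
  exact: sum_set_splits.
split.
  split.
  - by move=> L /dec.
  - move=> L L' /set_mem adm /set_mem adm' [_ eq2].
    rewrite -(sum_setI sD adm) -(sum_setI sD adm'); congr (_ `&` _).
    apply: (proj_comp_inj hA hB _ _ (sum_set_proj sD adm) (sum_set_proj sD adm')) eq2.
    + exact: sum_set_submod adm.
    + exact: sum_set_submod adm'.
    + by have [] := sum_set_splits sD adm.
    + by have [] := sum_set_splits sD adm'.
  - move=> [C1 C2] /= dC; have [spl PC] := decomposition_splits hA hB dC.
    have [[bC1 bC2] BE _ _ _] := dC.
    have sR : submod_closed (mem (range C2)).
      have lC2 := bounded_linear bC2.
      apply/submodP; split; first by exists 0 => //; rewrite lin0.
      by move=> t _ _ [u _ <-] [v _ <-]; exists (t *: u + v) => //; rewrite lC2.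
    have sM := closure_submod sR.
    have cM := @closed_closure _ (range C2).
    have adm := splits_admissible sD sM cM spl.
    exists (closure (range C2) `&` closure (Ddom A B)) => //.
    have P2 f : B2 (closure (range C2) `&` closure (Ddom A B)) f = C2 f.
      rewrite /B2 /PM /Mspace (splits_sum_set sD sM cM spl) /=; apply: PC.
      by rewrite -{1}(splits_sum_set sD sM cM spl)
        -{2}(splits_sum_set sD sM cM spl); apply: sum_set_proj.
    congr (_, _); apply/funext => f; last exact: P2.
    by have := P2 f; rewrite /B1 /B2 /PMc /= => ->; rewrite BE addrK.
move=> L /dec [[bB1 bB2] BE _ ad _].
have lA := bounded_linear hA; have lB1 := bounded_linear bB1.
have op := almost_dominated_operator lA lB1 ad.
have op1 (Q : K -> K) : op_rel Q (Lrel A B) = Lrel A (Q \o B).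
  by rewrite /op_rel /Lrel image_comp.
split=> // [|T1 T2 _ _].
  apply/seteqP; split=> [[f g] gf|[f g] [h [hf hg]]].
    have -> : g = B1 L f := gf.
    by exists (A f); split => //; apply: RN_graph.
  by apply: op hg _; rewrite [h]hf; apply: RN_graph.
rewrite !op1; split=> [[-> -> _]|[-> ->]] //; split => //.
apply/seteqP; split=> [_ [f _ <-]|[h g] [_ [_ [[f _ [<- <-]] [f' _ [Af <-]] /= ->]]]].
  by exists (B1 L f), (B2 L f); split; [exists f|exists f|exact: BE].
(* The sum of the relations may pair different preimages [f] and [f'] of one
   point, but the kernel of [A] is contained in that of [B1 L]. *)
have -> : B1 L f = B1 L f'.
  have h1 : RN A (B1 L) (A f, B1 L f) by apply: RN_graph.
  have h2 : RN A (B1 L) (A f, B1 L f') by rewrite -Af; apply: RN_graph.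
  exact: op h1 h2.
by exists f' => //; rewrite -BE Af.
Qed.
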